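(* Let $A$ be a closed and densely defined linear operator in $H$ with domain $D(A)\subset H$. (1) If $A$ is right invertible and $\ker(A)\subseteq\ker(A^* )$, then $A$ is invertible. (2) If $A$ is left invertible and $\ker(A^* )\subseteq\ker(A)$, then $A$ is invertible. In particular, if $A$ is closed and densely defined and $\ker(A)=\ker(A^* )$, then the following are equivalent: $A$ is left invertible; $A$ is right invertible; $A$ is invertible.
   Context: $H$ is a complex separable Hilbert space; operators are linear, possibly unbounded; $B(H)$ is the set of everywhere defined bounded linear operators on $H$. For operators $S,T$ in $H$, $ST$ has domain $\{x\in D(T): Tx\in D(S)\}$, and $S\subset T$ means that $T$ extends $S$. For an operator $A$ with domain $D(A)\subset H$: - $A$ is right invertible if there is $B\in B(H)$ with $AB=I$ (on all of $H$); - $A$ is left invertible if there is $C\in B(H)$ with $CA\subset I$; - $A$ is invertible if there is $B\in B(H)$ with $AB=I$ and $BA\subset I$ (equivalently, $A$ is injective and $A^{-1}\in B(H)$). *)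

(* Defs.v *)
From HB Require Import structures.
From mathcomp Require Import all_boot all_order all_algebra.
From mathcomp Require Import sesquilinear complex.
From mathcomp Require Import boolp classical_sets cardinality reals topology normedtype.

Set Implicit Arguments.
Unset Strict Implicit.
Unset Printing Implicit Defensive.

Import Order.TTheory GRing.Theory Num.Theory Num.Def.
Import numFieldNormedType.Exports.

Local Open Scope classical_set_scope.
Local Open Scope ring_scope.
Local Open Scope complex_scope.

(* [{dot H for conjC}] is a positive definite form that is linear in its first
   argument and conjugate-linear in its second one. *)
HB.mixin Record CompleteNormedModule_isHilbert (R : realType) H
    of CompleteNormedModule R[i] H := {
  inner : {dot H for (@conjC R[i])} ;
  innerE : forall x : H, inner x x = `|x| ^+ 2
}.

#[short(type="hilbertType")]
HB.structure Definition Hilbert (R : realType) :=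
  {H of CompleteNormedModule R[i] H & CompleteNormedModule_isHilbert R H}.

Definition separable (T : topologicalType) : Prop :=
  exists2 D : set T, countable D & dense D.

Section Operators.
Context {R : realType} {H : hilbertType R}.

(* A possibly unbounded operator in H. The values of [op_fun] outside [dom] are
   meaningless, so operators are compared with [extends] and [op_eq] below,
   never with [=]. *)
Record operator := Operator {
  dom : set H ;
  op_fun :> H -> H ;
  dom0 : dom 0 ;
  dom_lin : forall (a : R[i]) (x y : H), dom x -> dom y -> dom (a *: x + y) ;
  op_lin : forall (a : R[i]) (x y : H), dom x -> dom y ->
    op_fun (a *: x + y) = a *: op_fun x + op_fun y
}.

Implicit Types S T A B C : operator.

Lemma op0 T : T 0 = 0.
Proof.
have := op_lin 1 (dom0 T) (dom0 T).
by rewrite !scale1r addr0 -{1}[T 0]addr0 => /addrI.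
Qed.

(* [extends T S] is S ⊂ T *)
Definition extends T S : Prop :=
  dom S `<=` dom T /\ (forall x, dom S x -> T x = S x).

Definition op_eq S T : Prop := extends T S /\ extends S T.

Definition id_op : operator :=
  @Operator [set: H] id I (fun _ _ _ _ _ => I) (fun _ _ _ _ _ => erefl).

Section Comp.
Variables S T : operator.

Let D : set H := [set x | dom T x /\ dom S (T x)].

Let D0 : D 0.
Proof. by split; rewrite ?op0; exact: dom0. Qed.

Let D_lin (a : R[i]) (x y : H) : D x -> D y -> D (a *: x + y).
Proof.
move=> [Tx STx] [Ty STy]; split; first exact: dom_lin.
by rewrite op_lin//; exact: dom_lin.
Qed.

Let f_lin (a : R[i]) (x y : H) : D x -> D y ->
  S (T (a *: x + y)) = a *: S (T x) + S (T y).
Proof. by move=> [Tx STx] [Ty STy]; rewrite !op_lin. Qed.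

Definition comp_op : operator := @Operator D (S \o T) D0 D_lin f_lin.

End Comp.

Definition bounded_op B : Prop :=
  dom B = [set: H] /\ exists M : R, forall x : H, `|B x| <= M%:C * `|x|.

Definition densely_defined A : Prop := dense (dom A).

Definition graph A : set (H * H)%type := [set p | dom A p.1 /\ p.2 = A p.1].

Definition closed_op A : Prop := closed (graph A).

Definition ker A : set H := [set x | dom A x /\ A x = 0].

Section Adjoint.
Variable A : operator.
Hypothesis dA : densely_defined A.

Definition adjoint_rel (y z : H) : Prop :=
  forall x, dom A x -> inner (A x) y = inner x z.

Lemma adjoint_rel_uniq (y z z' : H) :
  adjoint_rel y z -> adjoint_rel y z' -> z = z'.
Proof.
move=> yz yz'; apply/eqP; rewrite -subr_eq0; apply/eqP; set w := z - z'.
have ow x : dom A x -> inner x w = 0.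
  by move=> Ax; rewrite linearBr/= -yz// -yz'// subrr.
apply/eqP/negP => /negP w0.
have nw : 0 < `|w| by rewrite normr_gt0.
have [x [wx Ax]] : ball w `|w| `&` dom A !=set0.
  by apply: dA; [exists w; exact: ballxx|exact: ball_open].
move: wx; rewrite -ball_normE/= => wx.
have : `|w - x| ^+ 2 < `|w| ^+ 2 by rewrite ltr_pXn2r// nnegrE.
rewrite -!innerE dnormB.
have -> : inner w x = 0 by rewrite hermC/= ow// conjC0 mulr0.
rewrite conjC0 addr0 subr0 gtrDl innerE => x0.
by have := lt_le_trans x0 (exprn_ge0 2 (normr_ge0 x)); rewrite ltxx.
Qed.

Let D : set H := [set y | exists z, adjoint_rel y z].
Let f (y : H) : H := xget 0 [set z | adjoint_rel y z].

Let fP (y : H) : D y -> adjoint_rel y (f y).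
Proof. by move=> [z yz]; exact: (xgetI 0 yz). Qed.

Let rel_lin (a : R[i]) (y y' z z' : H) : adjoint_rel y z -> adjoint_rel y' z' ->
  adjoint_rel (a *: y + y') (a *: z + z').
Proof.
move=> yz yz' x Ax.
by rewrite !linearDr/= !linearZr_LR/= yz// yz'.
Qed.

Let D0 : D 0.
Proof. by exists 0 => x _; rewrite !linear0r. Qed.

Let D_lin (a : R[i]) (x y : H) : D x -> D y -> D (a *: x + y).
Proof. by move=> /fP Dx /fP Dy; exists (a *: f x + f y); exact: rel_lin. Qed.

Let f_lin (a : R[i]) (x y : H) : D x -> D y ->
  f (a *: x + y) = a *: f x + f y.
Proof.
move=> Dx Dy; apply: (@adjoint_rel_uniq (a *: x + y)).
  by apply: fP; exact: D_lin.
by apply: rel_lin; exact: fP.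
Qed.

(* A^*: y is in the domain iff there is z, necessarily unique as A is densely
   defined, with <A x, y> = <x, z> for all x in the domain of A; then
   A^* y = z. *)
Definition adjoint : operator := @Operator D f D0 D_lin f_lin.

Lemma adjointP (y z : H) : dom adjoint y /\ adjoint y = z <-> adjoint_rel y z.
Proof.
split=> [[Dy <-]|yz]; first exact: fP.
have Dy : D y by exists z.
by split=> //; exact: (adjoint_rel_uniq (fP Dy)).
Qed.

End Adjoint.

Definition right_invertible A : Prop :=
  exists2 B, bounded_op B & op_eq (comp_op A B) id_op.

Definition left_invertible A : Prop :=
  exists2 C, bounded_op C & extends id_op (comp_op C A).

Definition invertible A : Prop :=
  exists2 B, bounded_op B &
    op_eq (comp_op A B) id_op /\ extends id_op (comp_op B A).

End Operators.

Arguments operator {R} H.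

(* Main.v *)
Require Import Defs.
From mathcomp Require Import all_boot all_order all_algebra ring lra.
From mathcomp Require Import sesquilinear.
From mathcomp Require Import complex boolp classical_sets reals topology normedtype.

(** Since <A x, y> = <x, A^* y>, the kernel of A^* is the orthogonal complement
    of the range of A ([ker_adjointP]). Each one-sided inverse gives half of
    what is needed, and the hypothesis on the kernels gives the other half.

    If A B = I, then A is onto, so ker A^* = 0, and ker A, being contained in
    it, vanishes as well. As A (B A x - x) = 0 for x in D(A), this gives
    B A x = x ([invertible_of_right]).

    If C A is contained in I, then A is injective, hence ker A^* = 0 and the
    range of A is dense. The range is also closed, being the preimage of the
    graph of A under the continuous map y |-> (C y, y) ([closed_range]). So A is
    onto, and A C (A x) = A x says that C is also a right inverse
    ([invertible_of_left]).

    The fact that a closed subspace with trivial orthogonal complement is the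
    whole space ([closed_subspace_full]) rests on the projection theorem: each x
    has a nearest point l in the subspace, by the parallelogram law and
    completeness ([exists_nearest]), and x - l is orthogonal to the subspace,
    since subtracting from it a multiple of a vector of the subspace does not
    shorten it ([shortest_orthogonal]). *)

Set Implicit Arguments.
Unset Strict Implicit.
Unset Printing Implicit Defensive.

Import Order.TTheory GRing.Theory Num.Theory Num.Def.
Import numFieldNormedType.Exports.

Local Open Scope classical_set_scope.
Local Open Scope ring_scope.
Local Open Scope complex_scope.

(** * Nearest points and closed subspaces *)

(** The norm of H takes its values in R[i], where infima need not exist; the
    distance to a set has to be computed in R. *)
Definition rnorm (R : realType) (H : hilbertType R) (x : H) : R :=
  complex.Re `|x|.

Lemma rnormE (R : realType) (H : hilbertType R) (x : H) :
  `|x| = (rnorm x)%:C.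
Proof. by rewrite /rnorm RRe_real// normr_real. Qed.

Lemma rnorm_ge0 (R : realType) (H : hilbertType R) (x : H) : 0 <= rnorm x.
Proof. by rewrite -lecR -rnormE normr_ge0. Qed.

Lemma inner_orthC (R : realType) (H : hilbertType R) (x y : H) :
  inner x y = 0 -> inner y x = 0.
Proof. by move=> xy; rewrite hermC/= xy conjC0 mulr0. Qed.

Lemma parallelogram (R : realType) (H : hilbertType R) (x y : H) :
  rnorm (x + y) ^+ 2 + rnorm (x - y) ^+ 2 =
  2 * rnorm x ^+ 2 + 2 * rnorm y ^+ 2.
Proof.
apply: (@complexI R); rewrite !(rmorphXn, rmorph_nat, rmorphD, rmorphM)/= -!rnormE.
rewrite -!innerE dnormD dnormB; ring.
Qed.

(** Two points u and v of M whose distance to x is almost the infimum D have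
    their midpoint in M, hence at distance at least D from x, and the
    parallelogram law forces u and v to be close to each other. Thus the sets of
    almost nearest points form a Cauchy filter, and its limit is the nearest
    point. *)
Lemma exists_nearest (R : realType) (H : hilbertType R) (M : set H) (x : H) :
    M !=set0 -> closed M ->
    (forall u v, M u -> M v -> M (2^-1 *: (u + v))) ->
  exists2 l, M l & forall u, M u -> `|x - l| <= `|x - u|.
Proof.
move=> [m0 Mm0] cM midM.
pose E : set R := [set rnorm (x - m) | m in M].
have E0 : has_lbound E by exists 0 => _ [m _ <-]; exact: rnorm_ge0.
have infE : has_inf E by split=> //; exists (rnorm (x - m0)), m0.
pose D := inf E.
have D0 : 0 <= D.
  by apply: lb_le_inf; [case: infE|move=> _ [m _ <-]; exact: rnorm_ge0].
have DM m : M m -> D <= rnorm (x - m) by move=> Mm; apply: ge_inf => //; exists m.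
pose B (e : R) : set H := [set m | M m /\ rnorm (x - m) < D + e].
have B0 e : 0 < e -> B e !=set0.
  by move=> e0; have [_ [m Mm <-] mD] := inf_adherent e0 infE; exists m.
pose F := filter_from [set e : R | 0 < e] B.
have FF : Filter F.
  apply: filter_from_filter; first by exists 1; rewrite /= ltr01.
  move=> i j /= i0 j0; exists (Num.min i j); first by rewrite /= lt_min i0.
  move=> m [Mm]; rewrite -ltrBlDl lt_min => /andP[mi mj].
  by split; split=> //; rewrite -ltrBlDl.
have PF : ProperFilter F by exact: filter_from_proper.
have FM : F M by exists 1; [rewrite /= ltr01|move=> m []].
have close e u v : B e u -> B e v -> rnorm (u - v) ^+ 2 <= 4 * e * (2 * D + e).
  move=> [Mu uD] [Mv vD].
  have := DM _ (midM _ _ Mu Mv); set a := rnorm (x - _) => Da.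
  have := parallelogram (x - u) (x - v).
  have -> : x - u + (x - v) = 2 *: (x - 2^-1 *: (u + v)).
    rewrite scalerBr scalerA mulfV ?pnatr_eq0// scale1r scaler_nat mulr2n.
    by rewrite opprD addrACA.
  have -> : x - u - (x - v) = - (u - v) by rewrite !opprB addrC addrA subrK.
  have -> : rnorm (2 *: (x - 2^-1 *: (u + v))) = 2 * a.
    apply: (@complexI R); rewrite rmorphM/= -!rnormE normrZ normr_nat.
    by rewrite rmorph_nat.
  have -> : rnorm (- (u - v)) = rnorm (u - v) by rewrite /rnorm normrN.
  have := rnorm_ge0 (x - u); have := rnorm_ge0 (x - v).
  move: uD vD; set p := rnorm (x - u); set q := rnorm (x - v); set r := rnorm _.
  nra.
have : cauchy F.
  apply/cauchyP => /= e e0.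
  have eE : e = (complex.Re e)%:C by rewrite RRe_real// gtr0_real.
  move: e0; rewrite eE ltcR; set r := complex.Re e => r0.
  (* For d <= 1, the bound 4 d (2 D + d) of [close] is at most d (8 D + 4); the
     larger factor 8 D + 8 makes it less than r^2. *)
  pose d := Num.min 1 (r ^+ 2 / (8 * D + 8)).
  have D8 : 0 < 8 * D + 8 by nra.
  have d0 : 0 < d by rewrite /d lt_min ltr01/= divr_gt0// exprn_gt0.
  have d1 : d <= 1 by rewrite /d ge_min lexx.
  have dr : d * (8 * D + 8) <= r ^+ 2.
    by rewrite -ler_pdivlMr// /d ge_min lexx orbT.
  have [m Bm] := B0 _ d0; exists m; exists d => // u Bu.
  rewrite -ball_normE/= rnormE ltcR.
  have := close _ _ _ Bm Bu; have := rnorm_ge0 (m - u).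
  set s := rnorm _; nra.
move/cauchy_cvgP/cvg_ex => [l Fl].
have Ml : M l by apply: (closed_cvg (F:=F) (u_:=id) M cM FM l); exact: Fl.
exists l => // u Mu; rewrite !rnormE lecR; apply: le_trans (DM _ Mu).
apply/ler_addgt0Pr => e e0.
have e2 : 0 < e / 2 by rewrite divr_gt0.
have : F (ball l (e / 2)%:C `&` B (e / 2)).
  apply: filterI; last by exists (e / 2).
  by apply: Fl; apply: nbhsx_ballx; rewrite ltcR.
move/filter_ex => [m []]; rewrite -ball_normE/= rnormE ltcR => ml [_ mD].
have : rnorm (x - l) <= rnorm (x - m) + rnorm (l - m).
  rewrite -lecR rmorphD/= -!rnormE (distrC l).
  by rewrite -[x - l](subrKA m) ler_normD.
lra.
Qed.

(** With a = <w, u> / <u, u>, the vector a u is the projection of w on u, and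
    |w - a u|^2 = |w|^2 - |<w, u>|^2 / <u, u>. *)
Lemma shortest_orthogonal (R : realType) (H : hilbertType R) (w u : H) :
  (forall a : R[i], `|w| <= `|w - a *: u|) -> inner w u = 0.
Proof.
move=> wmin; have [->|u0] := eqVneq u 0; first by rewrite linear0r.
have uu : 0 < inner u u by rewrite dnorm_gt0.
have /CrealP uuc : inner u u \is Num.real by rewrite gtr0_real.
set c := inner w u; set n := inner u u in uu uuc *.
have := wmin (c / n).
rewrite -(@ler_pXn2r _ 2)// ?nnegrE// -!innerE dnormB dnormZ/=.
rewrite linearZr_LR/= -/c -/n.
have nK : n != 0 by rewrite gt_eqF.
rewrite normCK !(rmorphM, fmorphV)/= conjCK !uuc.
have -> : inner w w + c / n * (conjC c / n) * n
    - (conjC c / n * c + c / n * conjC c) = inner w w - c * conjC c / n.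
  by field.
rewrite lerBrDr gerDl -normCK pmulr_lle0 ?invr_gt0// => c0.
by apply/eqP; rewrite -normr_eq0 -sqrf_eq0 eq_le c0 exprn_ge0.
Qed.

(** For any x with nearest point l in M, the vector x - l is orthogonal to M,
    hence zero. *)
Lemma closed_subspace_full (R : realType) (H : hilbertType R) (M : set H) :
    closed M -> M 0 ->
    (forall (a : R[i]) u v, M u -> M v -> M (a *: u + v)) ->
    (forall w, (forall u, M u -> inner u w = 0) -> w = 0) ->
  M = [set: H].
Proof.
move=> cM M0 linM perpM; apply/seteqP; split=> // x _.
have MZ (a : R[i]) u : M u -> M (a *: u).
  by move=> Mu; rewrite -[a *: u]addr0; exact: linM.
have MD u v : M u -> M v -> M (u + v).
  by move=> Mu Mv; rewrite -[u]scale1r; exact: linM.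
have [||l Ml lmin] := @exists_nearest _ _ M x _ cM; first by exists 0.
  by move=> u v Mu Mv; apply/MZ/MD.
suff /eqP : x - l = 0 by rewrite subr_eq0 => /eqP ->.
apply: perpM => u Mu; apply/inner_orthC/shortest_orthogonal => a.
by rewrite -addrA -opprD; apply: lmin; apply: MD => //; exact: MZ.
Qed.

(** * Kernels, ranges and one-sided inverses *)

Lemma ker_adjointP (R : realType) (H : hilbertType R) (A : operator H)
    (dA : densely_defined A) (y : H) :
  ker (adjoint dA) y <-> forall x, dom A x -> inner (A x) y = 0.
Proof.
rewrite /ker/= (adjointP dA y 0); split=> yA x Ax; first by rewrite yA// linear0r.
by rewrite yA// linear0r.
Qed.

Lemma bounded_op_continuous (R : realType) (H : hilbertType R)
  (C : operator H) : bounded_op C -> continuous C.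
Proof.
move=> [domC [K CK]] y.
have CB z : C y - C z = C (y - z).
  have Cz v : dom C v by rewrite domC.
  by rewrite addrC -scaleN1r -op_lin// scaleN1r addrC.
apply/cvgrPdist_lt => e e0.
have K0 : 0 < (`|K| + 1)%:C :> R[i] by rewrite ltcR ltr_wpDl.
near=> z; rewrite CB; apply: (@le_lt_trans _ _ ((`|K| + 1)%:C * `|y - z|)).
  apply: (le_trans (CK _)); rewrite ler_wpM2r// lecR.
  by rewrite (le_trans (ler_norm K))// lerDl.
rewrite mulrC -ltr_pdivlMr//; near: z.
by apply: cvgr_dist_lt; [exact: cvg_id|exact: divr_gt0].
Unshelve. all: by end_near. Qed.

Lemma left_inverseP (R : realType) (H : hilbertType R) (A C : operator H) :
  bounded_op C -> extends id_op (comp_op C A) <->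
    forall x, dom A x -> C (A x) = x.
Proof.
move=> [domC _]; split=> [[_ CA] x Ax|CA]; last first.
  by split=> // x [Ax _]; rewrite /= CA.
by have /= <- := CA x; rewrite ?domC.
Qed.

Lemma right_inverseP (R : realType) (H : hilbertType R) (A B : operator H) :
  bounded_op B -> op_eq (comp_op A B) id_op <->
    forall y, dom A (B y) /\ A (B y) = y.
Proof.
move=> [domB _]; split=> [[_ [AB ABE]] y|AB].
  by split; [have [] := AB y I|exact: ABE].
split; split=> //= y.
- by move=> _; rewrite (AB y).2.
- by move=> _; split; [rewrite domB|exact: (AB y).1].
- by move=> _; rewrite (AB y).2.
Qed.

(** If C A is contained in I, then y = A x forces x = C y, so y is in the range
    of A exactly when (C y, y) is in the graph of A, a closed condition on y. *)
Lemma closed_range (R : realType) (H : hilbertType R) (A : operator H) :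
  closed_op A -> left_invertible A -> closed (A @` dom A).
Proof.
move=> cA [C bC /(left_inverseP _ bC) CA].
have -> : A @` dom A = (fun y => (C y, y)) @^-1` graph A.
  apply/seteqP; split=> [_ [x Ax <-]|y [/= ACy ->]]; last by exists (C y).
  by split; rewrite /= CA.
apply: preimage_closed cA => y _.
by apply: cvg_pair; [exact: bounded_op_continuous|exact: cvg_id].
Qed.

(** A left inverse makes ker A trivial, so ker A^* = 0 and the range of A is
    dense; as it is closed too, A is onto. *)
Lemma invertible_of_left (R : realType) (H : hilbertType R)
    (A : operator H) (dA : densely_defined A) : closed_op A ->
  ker (adjoint dA) `<=` ker A -> left_invertible A -> invertible A.
Proof.
move=> cA kA lA; have cR := closed_range cA lA.
have [C bC /(left_inverseP _ bC) CA] := lA.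
have rA : A @` dom A = [set: H].
  apply: closed_subspace_full => //.
  - by exists 0; [exact: dom0|exact: op0].
  - move=> a _ _ [x Ax <-] [y Ay <-].
    by exists (a *: x + y); [exact: dom_lin|exact: op_lin].
  move=> w wA; have [Aw Aw0] : ker A w.
    by apply/kA/ker_adjointP => x Ax; apply: wA; exists x.
  by rewrite -[w]CA// Aw0 op0.
exists C => //; split; last exact/left_inverseP.
apply/right_inverseP => // y.
have [x Ax <-] : (A @` dom A) y by rewrite rA.
by rewrite CA.
Qed.

(** An element of ker A is in ker A^*, hence orthogonal to the range of A, which
    is all of H. So A is injective, and B A x = x because both sides have the
    same image under A. *)
Lemma invertible_of_right (R : realType) (H : hilbertType R)
    (A : operator H) (dA : densely_defined A) :
  ker A `<=` ker (adjoint dA) -> right_invertible A -> invertible A.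
Proof.
move=> kA [B bB AB]; exists B => //; split=> //.
move: AB => /(right_inverseP _ bB) AB; apply/left_inverseP => // x Ax.
have [Bx ABx] := AB (A x).
have kx : ker A (- 1 *: x + B (A x)).
  by split; [exact: dom_lin|rewrite op_lin// ABx scaleN1r addNr].
have /ker_adjointP k0 := kA _ kx.
set u := _ + _ in k0.
have [Bu ABu] := AB u.
(* u = A (B u) is in the range, hence orthogonal to itself. *)
have := k0 _ Bu; rewrite ABu => /eqP; rewrite dnorm_eq0 /u scaleN1r addrC.
by rewrite subr_eq0 => /eqP.
Qed.

Theorem theorem2p3 (R : realType) (H : hilbertType R) (sepH : separable H)
    (A : operator H) (cA : closed_op A) (dA : densely_defined A) :
  [/\ right_invertible A -> ker A `<=` ker (adjoint dA) -> invertible A,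
      left_invertible A -> ker (adjoint dA) `<=` ker A -> invertible A &
      ker A = ker (adjoint dA) ->
        (left_invertible A <-> right_invertible A) /\
        (right_invertible A <-> invertible A)].
Proof.
have ir : invertible A -> right_invertible A by move=> [B bB []]; exists B.
have il : invertible A -> left_invertible A by move=> [B bB []]; exists B.
split=> [rA kA|lA kA|kA].
- exact: invertible_of_right kA rA.
- exact: invertible_of_left kA lA.
have ri : right_invertible A -> invertible A.
  by apply: invertible_of_right; rewrite -kA.
have li : left_invertible A -> invertible A.
  by apply: invertible_of_left; rewrite -?kA.
by split; split=> // [/li|/ri].
Qed.
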